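(* Let $F=(f_1,f_2)$ be a $2\times2$ fewnomial system of type $(3,3)$ and let $P_F=\mathrm{Newt}(f_1)+\mathrm{Newt}(f_2)$ be the Minkowski sum of the Newton polygons. If $P_F$ is a line segment, then $F$ has at most $0$ isolated roots in $\mathbb{R}^2_+$; if $P_F$ is a triangle, then $F$ has at most $2$ isolated roots in $\mathbb{R}^2_+$; if $P_F$ is an $\ell$-gon with $\ell\in\{4,5\}$, then $F$ has at most $4$ isolated roots in $\mathbb{R}^2_+$.
   Context: Let $\mathbb{R}^2_+=\{(x_1,x_2)\in\mathbb{R}^2: x_1,x_2>0\}$ and, for $a\in\mathbb{R}^2$, $x^a=x_1^{a_1}x_2^{a_2}$ (real exponents allowed). A $2\times2$ fewnomial system of type $(3,3)$ is a pair $F=(f_1,f_2)$ where each $f_i(x)=\sum_a c_ax^a$ has exactly three monomial terms (distinct exponent vectors in $\mathbb{R}^2$, nonzero real coefficients). $\mathrm{Newt}(f)$ is the convex hull of the set of exponent vectors occurring in $f$. An arc is any homeomorphic image of the unit circle or of a (closed, open, or half-open) interval; a root $\zeta$ of $F$ is isolated if the only arc of real roots of $F$ containing $\zeta$ is $\{\zeta\}$ itself. *)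

(* Defs.v *)
From HB Require Import structures.
From mathcomp Require Import all_boot all_order all_algebra.
From mathcomp Require Import all_classical all_reals all_analysis.

Set Implicit Arguments.
Unset Strict Implicit.
Unset Printing Implicit Defensive.

Import Order.TTheory GRing.Theory Num.Theory.
Import numFieldNormedType.Exports.

Local Open Scope classical_set_scope.
Local Open Scope ring_scope.

(* R^o rather than R, so that the product carries an lmodType R structure. *)
Notation plane R := (R^o * R^o)%type.

Definition convex_hull (R : realType) (A : set (plane R)) : set (plane R) :=
  smallest (fun C : set (plane R) => @convex_set R (plane R) C) A.

Definition minkowski_sum (R : realType) (A B : set (plane R)) :
  set (plane R) := [set a + b | a in A & b in B].

Definition is_segment (R : realType) (P : set (plane R)) : Prop :=
  exists p q : plane R, p <> q /\ P = convex_hull [set p; q].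

(* The vertices v are in convex position; as l > 2, they are not collinear, so
   P is a genuine (two-dimensional) convex polygon with exactly l vertices. *)
Definition is_polygon (R : realType) (l : nat) (P : set (plane R)) : Prop :=
  (2 < l)%N /\
  exists v : 'I_l -> plane R,
    (forall i, ~ convex_hull (v @` [set j | j != i]) (v i)) /\
    P = convex_hull (range v).

Record fewnomial (R : realType) (m : nat) := Fewnomial {
  expo : 'I_m -> plane R;
  coef : 'I_m -> R;
  expo_inj : injective expo;
  coef_neq0 : forall i, coef i != 0
}.

Definition monomial (R : realType) (x a : plane R) : R :=
  x.1 `^ a.1 * x.2 `^ a.2.

Definition feval (R : realType) (m : nat) (f : fewnomial R m) (x : plane R) :
  R := \sum_(i < m) coef f i * monomial x (expo f i).

Definition Newt (R : realType) (m : nat) (f : fewnomial R m) :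
  set (plane R) := convex_hull (range (expo f)).

Definition fewnomial_system (R : realType) (m1 m2 : nat) : Type :=
  (fewnomial R m1 * fewnomial R m2)%type.

Definition positive_quadrant (R : realType) : set (plane R) :=
  [set x | 0 < x.1 /\ 0 < x.2].

Definition positive_roots (R : realType) (m1 m2 : nat)
    (F : fewnomial_system R m1 m2) : set (plane R) :=
  [set x | [/\ positive_quadrant x, feval F.1 x = 0 & feval F.2 x = 0]].

Definition homeomorphic (T U : topologicalType) (A : set T) (B : set U) :
  Prop :=
  exists (f : T -> U) (g : U -> T),
    [/\ set_fun A B f, set_fun B A g,
        (forall x, A x -> g (f x) = x) /\ (forall y, B y -> f (g y) = y),
        {within A, continuous f} & {within B, continuous g}].

Definition unit_circle (R : realType) : set (plane R) :=
  [set x | x.1 ^+ 2 + x.2 ^+ 2 = 1].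

(* The interval i may be a single point `[a, a], so that [set z] is always an
   arc; unbounded intervals, homeomorphic to bounded ones, are included too. *)
Definition is_arc (R : realType) (A : set (plane R)) : Prop :=
  homeomorphic (@unit_circle R) A \/
  exists i : interval R, homeomorphic [set` i] A.

Definition isolated_root (R : realType) (m1 m2 : nat)
    (F : fewnomial_system R m1 m2) (z : plane R) : Prop :=
  positive_roots F z /\
  forall A : set (plane R),
    is_arc A -> A `<=` positive_roots F -> A z -> A = [set z].

(* Main.v *)
Require Import Defs.
From mathcomp Require Import all_boot all_order all_algebra finmap.
From mathcomp Require Import all_classical all_reals all_analysis.
From mathcomp Require Import ring.

Set Implicit Arguments.
Unset Strict Implicit.
Unset Printing Implicit Defensive.

Import Order.TTheory GRing.Theory Num.Theory.
Import numFieldNormedType.Exports.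

Local Open Scope classical_set_scope.
Local Open Scope ring_scope.
Local Open Scope card_scope.

(* With y = ln x, a trinomial equation becomes c0 + c1 e^<u,y> + c2 e^<v,y> = 0
   after division by a monomial.

   If the exponents of f1 are collinear, its zero set is a union of at most two
   parallel lines, and f2 restricted to a line is an exponential trinomial in
   one variable, with at most two zeros unless it vanishes identically; this
   gives 4.  If all exponents lie on parallel lines, then F is invariant along
   a line and no root is isolated.

   If f1 has a nondegenerate Newton triangle, its zero set is the curve
   v = l + m u, u, v > 0, parametrized by p = ln u.  When the triangles have
   parallel edges, f2 becomes c0 + c1 e^(r1 p) + c2 e^(r2 p) v^s;
   differentiating and dividing by exponentials twice leaves a quadratic
   polynomial in u, and Rolle's theorem gives 2 + 1 + 1 = 4.  When all three
   edges are parallel, f2 becomes c0 + c1 u^r + c2 v^r and two steps leave a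
   constant: 0 + 1 + 1 = 2.
   A function that vanishes identically makes the whole curve an arc of roots.

   It remains to see that few vertices of P_F force these configurations. A
   point a_i + b_j where a_i and b_j are both maximal for one lexicographic
   order is a vertex of P_F. For each edge of one triangle, the two orders
   with the outer normal first produce two such pairs; counting them gives
   six vertices when no edges are parallel, and four when some edge of one
   triangle is parallel to no edge of the other, or when a Newton polygon
   degenerates and P_F does not. *)

(** * Counting zeros by Rolle's theorem *)

(** Stated for duplicate-free lists, so that the zeros can be sorted without first proving that they
    are finite in number. *)
Definition zeros_le (R : realType) (J : set R) (h : R -> R) (n : nat) : Prop :=
  forall s : seq R, uniq s -> (forall x, x \in s -> J x /\ h x = 0) ->
  (size s <= n)%N.

Definition vanishes_or_zeros_le (R : realType) (J : set R) (h : R -> R)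
    (n : nat) : Prop :=
  (forall x, J x -> h x = 0) \/ zeros_le J h n.

Section Rolle_count.
Variables (R : realType) (J : set R) (g w h : R -> R).
Hypothesis Jitv : is_interval J.
Hypothesis dg : forall x, J x -> is_derive x 1 g (w x * h x).
Hypothesis w_neq0 : forall x, J x -> w x != 0.

Lemma within_itv x y : J x -> J y -> {subset `[x, y] <= J}.
Proof.
move=> Jx Jy z; rewrite in_itv /= => xzy.
by rewrite inE; apply: Jitv xzy.
Qed.

(** As [w] never vanishes on [J], the zero of the derivative given by Rolle's theorem is a zero of
    [h]; an exponential factor can thus be dropped after each differentiation. *)
Lemma rolle_between x y : x < y -> J x -> J y -> g x = 0 -> g y = 0 ->
  exists c, [/\ x < c, c < y, J c & h c = 0].
Proof.
move=> xy Jx Jy gx gy.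
have Jsub := within_itv Jx Jy.
have [c|||c cxy [_ gc]] := @Rolle R g x y xy.
- move=> /subset_itv_oo_cc /Jsub; rewrite inE => Jc.
  by have [] := dg Jc.
- apply: derivable_within_continuous => c /Jsub; rewrite inE => Jc.
  by have [] := dg Jc.
- by rewrite gx gy.
have Jc : J c by have /Jsub := subset_itv_oo_cc cxy; rewrite inE.
have [_ gc'] := dg Jc.
move: cxy; rewrite in_itv /= => /andP[xc cy].
exists c; split => //; apply/eqP.
have := w_neq0 Jc; rewrite gc in gc'.
by move/esym/eqP: gc'; rewrite mulf_eq0 => /orP[->|].
Qed.

(** The zeros of [h] lie in successive gaps between zeros of [g], so they increase strictly. Keeping
    [x] as the start of the path carries this through the induction. *)
Lemma rolle_path s x : path <%R x s ->
  (forall y, y \in x :: s -> J y /\ g y = 0) ->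
  exists s', [/\ size s' = size s, path <%R x s' &
    forall y, y \in s' -> J y /\ h y = 0].
Proof.
elim: s x => [|y s IHs] x /=; first by exists [::].
move=> /andP[xy ys] zs.
have [|s' [sz's ys' zs']] := IHs y ys.
  by move=> z zys; apply: zs; rewrite inE zys orbT.
have [Jx gx] := zs x (mem_head _ _).
have [|Jy gy] := zs y; first by rewrite !inE eqxx orbT.
have [c [xc cy Jc hc]] := rolle_between xy Jx Jy gx gy.
exists (c :: s'); split; rewrite /= ?sz's ?xc //.
- case: s' ys' {sz's zs'} => //= z s' /andP[yz ->].
  by rewrite (lt_trans cy yz).
- by move=> z; rewrite inE => /predU1P[->//|/zs'].
Qed.

Lemma zeros_le_rolle n : zeros_le J h n -> zeros_le J g n.+1.
Proof.
move=> hn s us zs; rewrite -(size_sort <=%R).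
have: sorted <%R (sort <=%R s) by rewrite sort_lt_sorted.
have: forall x, x \in sort <=%R s -> J x /\ g x = 0.
  by move=> x; rewrite mem_sort; apply: zs.
case: (sort _ s) => // x t zt /rolle_path /(_ zt) [t' [/= <- xt' zt']].
apply: hn zt'; apply: (@sorted_uniq _ <%R lt_trans); first exact: ltxx.
exact: path_sorted xt'.
Qed.

(** If [h] vanishes on [J], the mean value theorem makes [g] constant there, so [g] vanishes or has
    no zero at all. *)
Lemma vanishes_or_zeros_le_rolle n :
  vanishes_or_zeros_le J h n -> vanishes_or_zeros_le J g n.+1.
Proof.
move=> [h0|hn]; last by right; apply: zeros_le_rolle.
have g_cst x y : J x -> J y -> x < y -> g x = g y.
  move=> Jx Jy xy; have Jsub := within_itv Jx Jy.
  have [||c] := @MVT R g (fun z => w z * h z) x y xy.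
  - by move=> c /subset_itv_oo_cc /Jsub; rewrite inE; apply: dg.
  - apply: derivable_within_continuous => c /Jsub; rewrite inE => Jc.
    by have [] := dg Jc.
  - move=> /subset_itv_oo_cc /Jsub; rewrite inE => /h0 ->.
    by rewrite mulr0 mul0r => /eqP; rewrite subr_eq0 => /eqP.
have [[x [Jx gx]]|nz] := pselect (exists x, J x /\ g x = 0).
  left=> y Jy; have [xy|yx|<-//] := ltgtP x y.
    by rewrite -(g_cst x y).
  by rewrite (g_cst y x).
right=> -[//|x s] _ zs; case: nz; exists x; apply: zs; exact: mem_head.
Qed.

End Rolle_count.

Lemma zeros_le_ext (R : realType) (J : set R) (g w h : R -> R) n :
    (forall x, J x -> g x = w x * h x) -> (forall x, J x -> w x != 0) ->
  zeros_le J h n -> zeros_le J g n.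
Proof.
move=> gE w0 hn s us zs; apply: hn us _ => x xs.
have [Jx gx] := zs _ xs; split=> //; apply/eqP.
by move/eqP: gx; rewrite gE // mulf_eq0 (negPf (w0 x Jx)).
Qed.

Lemma vanishes_or_zeros_le_ext (R : realType) (J : set R) (g w h : R -> R) n :
    (forall x, J x -> g x = w x * h x) -> (forall x, J x -> w x != 0) ->
  vanishes_or_zeros_le J h n -> vanishes_or_zeros_le J g n.
Proof.
move=> gE w0 [h0|hn]; last by right; apply: (zeros_le_ext gE w0 hn).
by left=> x Jx; rewrite gE // h0 // mulr0.
Qed.

Lemma cst_zeros (R : realType) (J : set R) (c : R) :
  vanishes_or_zeros_le J (fun=> c) 0.
Proof.
have [->|c0] := eqVneq c 0; first by left.
right=> -[//|x s] _ /(_ x (mem_head _ _)) [_ cE].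
by move: c0; rewrite cE eqxx.
Qed.

(** Since [expR] is injective, distinct zeros give distinct roots of a polynomial of degree at most
    two. *)
Lemma quadratic_zeros (R : realType) (J : set R) (A B C : R) :
  vanishes_or_zeros_le J
    (fun x => A + B * expR x + C * expR x ^+ 2) 2.
Proof.
pose p := Poly [:: A; B; C].
have pE x : p.[x] = A + B * x + C * x ^+ 2.
  by rewrite /p horner_Poly /=; ring.
have [p0|p0] := eqVneq p 0.
  by left=> x _; rewrite -pE p0 horner0.
right=> s us zs; rewrite -(size_map (@expR R)) -ltnS.
apply: leq_trans (size_Poly [:: A; B; C]).
apply: max_poly_roots p0 _ _.
  apply/allP => _ /mapP[x xs ->]; rewrite /root pE.
  by have [_ ->] := zs _ xs.
by rewrite map_inj_uniq //; apply: expR_inj.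
Qed.

Lemma is_derive_expR_comp (R : realType) (f : R -> R) (x df : R) :
  is_derive x 1 f df -> is_derive x 1 (fun z => expR (f z)) (expR (f x) * df).
Proof. by move=> fx; apply: (@is_derive1_comp R (@expR R) f). Qed.

Lemma is_derive_affine2 (R : realType) (f : R -> R) (a b x df : R) :
  is_derive x 1 f df -> is_derive x 1 (fun z => a * z + b * f z) (a + b * df).
Proof.
move=> fx.
have : is_derive x 1 (a \*: id + b \*: f) (a *: 1 + b *: df).
  by apply: is_deriveD.
by rewrite /GRing.scale /= mulr1.
Qed.

Lemma is_derive_affine (R : realType) (f : R -> R) (c d x df : R) :
  is_derive x 1 f df -> is_derive x 1 (fun z => c + d * f z) (d * df).
Proof.
move=> fx; have : is_derive x 1 (cst c + d \*: f) (0 + d *: df).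
  by apply: is_deriveD.
by rewrite add0r.
Qed.

Lemma is_derive1_congr (R : realType) (f g : R -> R) (x df dg : R) :
  is_derive x 1 f df -> f =1 g -> df = dg -> is_derive x 1 g dg.
Proof. by move=> fx /funext <- <-. Qed.

Lemma is_derive_expR_linear (R : realType) (r x : R) :
  is_derive x 1 (fun z => expR (r * z)) (r * expR (r * x)).
Proof.
apply: is_derive1_congr
  (is_derive_expR_comp (is_derive_affine 0 r (is_derive_id x (1 : R)))) _ _.
  by move=> z; rewrite add0r.
by rewrite add0r mulr1 mulrC.
Qed.

(** The first exponential is factored out so that the cofactor is a binomial, ready for the next
    Rolle step. *)
Lemma is_derive_trinomial (R : realType) (c0 c1 c2 r1 r2 x : R) :
  is_derive x 1 (fun z => c0 + c1 * expR (r1 * z) + c2 * expR (r2 * z))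
    (expR (r1 * x) * (c1 * r1 + c2 * r2 * expR ((r2 - r1) * x))).
Proof.
apply: is_derive1_congr
  (is_deriveD (is_derive_affine c0 c1 (is_derive_expR_linear r1 x))
              (is_derive_affine 0 c2 (is_derive_expR_linear r2 x))) _ _.
  by move=> z; rewrite fctE /= add0r.
have -> : r2 * x = r1 * x + (r2 - r1) * x by ring.
by rewrite expRD; ring.
Qed.

Lemma is_derive_binomial (R : realType) (c1 c2 r x : R) :
  is_derive x 1 (fun z => c1 + c2 * expR (r * z)) (expR (r * x) * (c2 * r)).
Proof.
apply: is_derive1_congr
  (is_derive_affine c1 c2 (is_derive_expR_linear r x)) _ _.
  by [].
by ring.
Qed.

Lemma trinomial_zeros (R : realType) (J : set R) (c0 c1 c2 r1 r2 : R) :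
  is_interval J ->
  vanishes_or_zeros_le J
    (fun x => c0 + c1 * expR (r1 * x) + c2 * expR (r2 * x)) 2.
Proof.
move=> Jitv; apply: (@vanishes_or_zeros_le_rolle _ _ _ (fun x => expR (r1 * x))
  (fun x => c1 * r1 + c2 * r2 * expR ((r2 - r1) * x)) Jitv).
- by move=> x _; apply: is_derive_trinomial.
- by move=> x _; rewrite expR_eq0.
apply: (@vanishes_or_zeros_le_rolle _ _ _ (fun x => expR ((r2 - r1) * x))
  (fun=> c2 * r2 * (r2 - r1)) Jitv).
- by move=> x _; apply: is_derive_binomial.
- by move=> x _; rewrite expR_eq0.
exact: cst_zeros.
Qed.

(** Two Rolle steps leave the constant [c2 * r2 * (r2 - r1)], which the hypotheses make nonzero;
    this excludes identical vanishing. *)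
Lemma trinomial_zeros_le (R : realType) (c0 c1 c2 r1 r2 : R) :
  c2 != 0 -> r2 != 0 -> r1 != r2 ->
  zeros_le setT (fun x => c0 + c1 * expR (r1 * x) + c2 * expR (r2 * x)) 2.
Proof.
move=> c2_0 r2_0 r12; have Titv : is_interval (@setT R) by [].
apply: (@zeros_le_rolle _ _ _ (fun x => expR (r1 * x))
  (fun x => c1 * r1 + c2 * r2 * expR ((r2 - r1) * x)) Titv).
- by move=> x _; apply: is_derive_trinomial.
- by move=> x _; rewrite expR_eq0.
apply: (@zeros_le_rolle _ _ _ (fun x => expR ((r2 - r1) * x))
  (fun=> c2 * r2 * (r2 - r1)) Titv).
- by move=> x _; apply: is_derive_binomial.
- by move=> x _; rewrite expR_eq0.
case=> // x s _ /(_ x (mem_head _ _)) [_ /eqP].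
rewrite /= !mulf_eq0 subr_eq0 (eq_sym r2 r1).
by rewrite (negPf c2_0) (negPf r2_0) (negPf r12).
Qed.

(** * Zeros of a second trinomial along the curve of the first *)

Section Along_trinomial_curve.
Variables (R : realType) (l k : R).

(* The curve v = l + k u, u > 0, v > 0 is the image of line_dom under
   p |-> (u, v) = (exp p, exp (line_ln p)). *)
Definition line_dom : set R := [set p | 0 < l + k * expR p].
Definition line_ln (p : R) : R := ln (l + k * expR p).

Lemma line_dom_itv : is_interval line_dom.
Proof.
move=> x y; rewrite /line_dom /= => lx ly z /andP[xz zy].
have [k0|k0] := leP 0 k.
  by apply: lt_le_trans lx _; rewrite lerD2l ler_wpM2l // ler_expR.
by apply: lt_le_trans ly _; rewrite lerD2l ler_wnM2l // ?ler_expR // ltW.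
Qed.

(** Moving [p] in the direction in which [l + k * expR p] does not decrease stays in the domain.
    Hence a nonempty curve has more than one point. *)
Lemma line_domN p : line_dom p -> exists2 p', line_dom p' & p' != p.
Proof.
rewrite /line_dom /= => lp; exists (if 0 <= k then p + 1 else p - 1).
  have [k0|k0] := leP 0 k; apply: lt_le_trans lp _; rewrite lerD2l.
    by rewrite ler_wpM2l // ler_expR lerDl.
  by rewrite ler_wnM2l // ?(ltW k0) // ler_expR gerBl.
case: ifP => _; rewrite -subr_eq0.
  by rewrite addrAC subrr add0r oner_eq0.
by rewrite addrAC subrr add0r oppr_eq0 oner_eq0.
Qed.

Lemma expR_line_ln p : line_dom p -> expR (line_ln p) = l + k * expR p.
Proof. by move=> lp; rewrite lnK. Qed.

Lemma is_derive_line_ln p : line_dom p ->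
  is_derive p 1 line_ln (k * expR p / (l + k * expR p)).
Proof.
move=> lp; rewrite mulrC.
apply: (@is_derive1_comp _ (@ln R) (fun z => l + k * expR z)).
  exact: is_derive1_ln.
exact: is_derive_affine.
Qed.

Lemma is_derive_expR_line_ln (a b p : R) : line_dom p ->
  is_derive p 1 (fun z => expR (a * z + b * line_ln z))
    (expR (a * p + b * line_ln p) * (a + b * (k * expR p / (l + k * expR p)))).
Proof.
move=> lp; apply: is_derive_expR_comp.
exact: is_derive_affine2 (is_derive_line_ln lp).
Qed.

Lemma common_edge_zeros (c0 c1 c2 r1 r2 s : R) :
  vanishes_or_zeros_le line_dom
    (fun p => c0 + c1 * expR (r1 * p) + c2 * expR (r2 * p + s * line_ln p)) 4.
Proof.
pose v p := l + k * expR p.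
have v0 p : line_dom p -> v p != 0 by move=> lp; rewrite gt_eqF.
have dpoly (p : R) : is_derive p 1 (fun z => r2 * l + (r2 + s) * k * expR z)
    ((r2 + s) * k * expR p) by exact: is_derive_affine.
(* Write u = exp p and v = l + k u. Differentiating u^r2 v^s gives the factor r2 v + s k u = r2 l +
   (r2 + s) k u and lowers the exponent of v to s - 1. *)
refine (@vanishes_or_zeros_le_rolle _ _ _ (fun p => expR (r1 * p))
  (fun p => c1 * r1 + c2 * ((r2 * l + (r2 + s) * k * expR p) *
     expR ((r2 - r1) * p + (s - 1) * line_ln p))) line_dom_itv _ _ _ _).
- move=> p lp.
  apply: is_derive1_congr
    (is_deriveD (is_derive_affine c0 c1 (is_derive_expR_linear r1 p))
                (is_derive_affine 0 c2 (is_derive_expR_line_ln r2 s lp))) _ _.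
    by move=> z; rewrite fctE /= add0r.
  (* Splitting off one [line_ln p] exposes a factor v that cancels the denominator in the derivative
     of [line_ln]. *)
  have -> : r2 * p + s * line_ln p =
      r1 * p + ((r2 - r1) * p + (s - 1) * line_ln p) + line_ln p by ring.
  rewrite !expRD expR_line_ln // -/(v p).
  have := v0 p lp; rewrite /v => vp0.
  by field.
- by move=> p _; rewrite expR_eq0.
(* The constant [c1 * r1] disappears now; taking out u^(r2 - r1) v^(s - 2) leaves a polynomial of
   degree at most two in u. *)
refine (@vanishes_or_zeros_le_rolle _ _ _
  (fun p => expR ((r2 - r1) * p + (s - 2) * line_ln p))
  (fun p => c2 * ((r2 + s) * k * expR p * v p +
     (r2 * l + (r2 + s) * k * expR p) *
       ((r2 - r1) * v p + (s - 1) * k * expR p))) line_dom_itv _ _ _ _).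
- move=> p lp.
  apply: is_derive1_congr (is_derive_affine (c1 * r1) c2
    (is_deriveM (dpoly p) (is_derive_expR_line_ln (r2 - r1) (s - 1) lp))) _ _.
    by [].
  have -> : (r2 - r1) * p + (s - 1) * line_ln p =
      ((r2 - r1) * p + (s - 2) * line_ln p) + line_ln p by ring.
  rewrite /GRing.scale /= !expRD expR_line_ln // -/(v p).
  have := v0 p lp; rewrite /v => vp0.
  by field.
- by move=> p _; rewrite expR_eq0.
have := @quadratic_zeros R line_dom
  (c2 * (r2 - r1) * r2 * l ^+ 2)
  (c2 * k * l * ((r2 + s) + r2 * (s - r1 + r2 - 1) + (r2 + s) * (r2 - r1)))
  (c2 * k ^+ 2 * (r2 + s) * (s - r1 + r2)).
apply: (@vanishes_or_zeros_le_ext _ _ _ (fun=> 1)) => [p _|p _].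
  by rewrite /v; ring.
exact: oner_neq0.
Qed.

(** With u = exp p and v = l + k u, dividing the derivative by u^r leaves a constant plus a multiple
    of (v/u)^(r - 1). The derivative of that power has a constant numerator up to a nonvanishing
    factor, because v - k u = l. *)
Lemma homothetic_zeros (c0 c1 c2 r : R) :
  vanishes_or_zeros_le line_dom
    (fun p => c0 + c1 * expR (r * p) + c2 * expR (r * line_ln p)) 2.
Proof.
pose v p := l + k * expR p.
have v0 p : line_dom p -> v p != 0 by move=> lp; rewrite gt_eqF.
refine (@vanishes_or_zeros_le_rolle _ _ _ (fun p => expR (r * p))
  (fun p => r * c1 + r * c2 * k *
     expR ((1 - r) * p + (r - 1) * line_ln p)) line_dom_itv _ _ _ _).
- move=> p lp.
  apply: is_derive1_congr
    (is_deriveD (is_derive_affine c0 c1 (is_derive_expR_linear r p))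
                (is_derive_affine 0 c2 (is_derive_expR_line_ln 0 r lp))) _ _.
    by move=> z; rewrite fctE /= !add0r mul0r add0r.
  have -> : 0 * p + r * line_ln p = (r - 1) * line_ln p + line_ln p by ring.
  have -> : (1 - r) * p + (r - 1) * line_ln p =
      p + (r - 1) * line_ln p - r * p by ring.
  rewrite !expRD expRN expR_line_ln // -/(v p).
  have := v0 p lp; rewrite /v => vp0; have := expR_gt0 (r * p).
  set E := expR (r * p) => /gt_eqF/negbT E0.
  by field; rewrite E0 vp0.
- by move=> p _; rewrite expR_eq0.
refine (@vanishes_or_zeros_le_rolle _ _ _
  (fun p => expR ((1 - r) * p + (r - 1) * line_ln p) / v p)
  (fun=> r * c2 * k * (1 - r) * l) line_dom_itv _ _ _ _).
- move=> p lp.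
  apply: is_derive1_congr (is_derive_affine (r * c1) (r * c2 * k)
    (is_derive_expR_line_ln (1 - r) (r - 1) lp)) _ _.
    by [].
  have := v0 p lp; rewrite /v => vp0.
  by field.
- by move=> p lp; rewrite mulf_eq0 invr_eq0 expR_eq0 (negPf (v0 _ lp)).
exact: cst_zeros.
Qed.

End Along_trinomial_curve.

(** * Isolated roots in logarithmic coordinates *)

Section Plane.
Variable R : realType.
Implicit Types p q x y a : plane R.

Definition dot p q : R := p.1 * q.1 + p.2 * q.2.
Definition cross p q : R := p.1 * q.2 - p.2 * q.1.

Definition exp2 y : plane R := (expR y.1, expR y.2).
Definition ln2 x : plane R := (ln x.1, ln x.2).

Lemma exp2_quadrant y : positive_quadrant (exp2 y).
Proof. by split; exact: expR_gt0. Qed.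

Lemma exp2K : cancel exp2 ln2.
Proof. by case=> y1 y2; rewrite /ln2 /= !expRK. Qed.

Lemma ln2K x : positive_quadrant x -> exp2 (ln2 x) = x.
Proof. by case: x => x1 x2 [/= x1_0 x2_0]; rewrite /exp2 /= !lnK. Qed.

Lemma monomial_exp2 y a : monomial (exp2 y) a = expR (dot a y).
Proof. by rewrite /monomial /powR /= !expR_eq0 !expRK expRD. Qed.

Lemma feval_exp2 m (f : fewnomial R m) y :
  feval f (exp2 y) = \sum_(i < m) coef f i * expR (dot (expo f i) y).
Proof. by apply: eq_bigr => i _; rewrite monomial_exp2. Qed.

Lemma positive_roots_exp2 m1 m2 (F : fewnomial_system R m1 m2) y :
  positive_roots F (exp2 y) <->
  feval F.1 (exp2 y) = 0 /\ feval F.2 (exp2 y) = 0.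
Proof. by split=> [[]//|[? ?]]; split => //; exact: exp2_quadrant. Qed.

(** The functional [w] applied to logarithms recovers the parameter, so the curve has a continuous
    inverse and is an arc of roots. Isolation would shrink it to a point, but there are two distinct
    parameters. *)
Lemma curve_not_isolated m1 m2 (F : fewnomial_system R m1 m2) (J : set R)
    (g1 g2 : R -> R) (w : plane R) :
    is_interval J ->
    (forall t, J t -> {for t, continuous g1}) ->
    (forall t, J t -> {for t, continuous g2}) ->
    (forall t, J t -> dot w (g1 t, g2 t) = t) ->
    (forall t, J t -> positive_roots F (exp2 (g1 t, g2 t))) ->
    (forall t, J t -> exists2 t', J t' & t' != t) ->
  forall t, J t -> ~ isolated_root F (exp2 (g1 t, g2 t)).
Proof.
move=> Jitv cg1 cg2 wg rts JN t Jt [_ iso].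
pose g s : plane R := exp2 (g1 s, g2 s).
have [t' Jt' t't] := JN t Jt.
have gK s : J s -> dot w (ln2 (g s)) = s by move=> Js; rewrite exp2K wg.
have : g @` J = [set g t].
  apply: iso; last by exists t.
    (* [is_arc] asks for a syntactic interval; [Rhull J] is one and has the same points as [J]. *)
    right; exists (Rhull J); have /is_intervalP <- := Jitv.
    exists g, (fun x => dot w (ln2 x)); split.
    - by move=> s Js; exists s.
    - by move=> _ [s Js <-]; rewrite gK.
    - by split=> [s|_ [s Js <-]]; first exact: gK; rewrite gK.
    - apply: continuous_in_subspaceT => s; rewrite inE => Js.
      have ce (h : R -> R) : {for s, continuous h} ->
          expR (h z) @[z --> s] --> expR (h s).
        by move=> ch; apply: continuous_comp ch _; exact: continuous_expR.
      exact: (cvg_pair (ce _ (cg1 s Js)) (ce _ (cg2 s Js))).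
    - apply: continuous_in_subspaceT => x; rewrite inE => -[s Js sx].
      have [x1_0 x2_0] : positive_quadrant x.
        by rewrite -sx; apply: exp2_quadrant.
      have cl (c : R) (h : plane R -> R) : 0 < h x ->
          {for x, continuous h} -> c * ln (h z) @[z --> x] --> c * ln (h x).
        move=> hx ch; apply: cvgMr => //.
        by apply: continuous_comp ch _; exact: continuous_ln.
      exact: (cvgD (cl w.1 fst x1_0 cvg_fst) (cl w.2 snd x2_0 cvg_snd)).
  by move=> _ [s Js <-]; apply: rts.
move/seteqP => [/(_ (g t'))/= gt't _].
move: t't; rewrite -(gK t') // gt't; last by exists t'.
by rewrite gK // eqxx.
Qed.

End Plane.

Section PlaneAlgebra.
Variable R : realType.
Implicit Types (p q r d : plane R) (c : R).

Lemma crossE (p1 p2 q1 q2 : R) : cross (p1, p2) (q1, q2) = p1 * q2 - p2 * q1.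
Proof. by []. Qed.

Lemma dotE (p1 p2 q1 q2 : R) : dot (p1, p2) (q1, q2) = p1 * q1 + p2 * q2.
Proof. by []. Qed.

Lemma planeB (p1 p2 q1 q2 : R) :
  (p1, p2) - (q1, q2) = (p1 - q1, p2 - q2) :> plane R.
Proof. by []. Qed.

Lemma dotBl p q r : dot (p - q) r = dot p r - dot q r.
Proof.
move: p q r => [p1 p2] [q1 q2] [r1 r2]; rewrite planeB !dotE; ring.
Qed.

Lemma crossBl p q r : cross (p - q) r = cross p r - cross q r.
Proof.
move: p q r => [p1 p2] [q1 q2] [r1 r2]; rewrite planeB !crossE; ring.
Qed.

Lemma crossBr p q r : cross p (q - r) = cross p q - cross p r.
Proof.
move: p q r => [p1 p2] [q1 q2] [r1 r2]; rewrite planeB !crossE; ring.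
Qed.

Lemma dotself_gt0 d : d != 0 -> 0 < dot d d.
Proof.
move: d => [d1 d2]; rewrite xpair_eqE /= dotE negb_and => d0.
have := sqr_ge0 d1; have := sqr_ge0 d2; rewrite -!expr2 => d2_0 d1_0.
case/orP: d0 => [d0|d0].
  by rewrite ltr_wpDr // lt_def sqrf_eq0 d0.
by rewrite ltr_wpDl // lt_def sqrf_eq0 d0.
Qed.

End PlaneAlgebra.

Lemma mem_ord3 (i j k t : 'I_3) : uniq [:: i; j; k] -> t \in [:: i; j; k].
Proof.
by move: i j k t; do 4![case=> [[|[|[|//]]] ?]].
Qed.

Lemma sum_ord3 (V : nmodType) (f : 'I_3 -> V) (i j k : 'I_3) :
  uniq [:: i; j; k] -> \sum_(t < 3) f t = f i + f j + f k.
Proof.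
move=> u; have -> : \sum_(t < 3) f t = \sum_(t <- [:: i; j; k]) f t.
  apply: perm_big; apply: uniq_perm; rewrite ?index_enum_uniq // => t.
  by rewrite mem_index_enum mem_ord3.
by rewrite !big_cons big_nil addr0 addrA.
Qed.

Section IsolatedRoots.
Variable R : realType.
Implicit Type F : fewnomial_system R 3 3.

Definition isolated_le F (n : nat) : Prop :=
  forall s : seq (plane R),
    uniq s -> (forall z, z \in s -> isolated_root F z) -> (size s <= n)%N.

(** An infinite set would contain a finite subset with [n.+1] elements, so the bound on lists
    already yields finiteness. *)
Lemma isolated_le_card F n :
  isolated_le F n -> [set z | isolated_root F z] #<= `I_n.
Proof.
move=> Fn; set S := [set z | _].
have Sle (B : {fset plane R}) : [set` B] `<=` S -> (size B <= n)%N.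
  by move=> BS; apply: Fn (fset_uniq B) _ => z zB; apply: BS.
have finS : finite_set S.
  apply: contrapT => /(infinite_set_fset n.+1) [B /Sle Bn].
  by rewrite ltnNge Bn.
rewrite -(fset_setK finS).
have /card_eq_fsetP/card_le_eql-> : size (fset_set S) = size (fset_set S) by [].
by rewrite card_le_II; apply: Sle; rewrite fset_setK.
Qed.

Lemma isolated_root_swap F z : isolated_root F z -> isolated_root (F.2, F.1) z.
Proof.
have rE : positive_roots (F.2, F.1) = positive_roots F.
  by apply/seteqP; split=> x [].
by rewrite /isolated_root rE.
Qed.

Lemma isolated_le_swap F n : isolated_le (F.2, F.1) n -> isolated_le F n.
Proof.
by move=> Fn s us zs; apply: Fn us _ => z /zs; apply: isolated_root_swap.
Qed.

Lemma isolated_leW F m n : (m <= n)%N -> isolated_le F m -> isolated_le F n.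
Proof. by move=> mn Fm s us /(Fm s us) /leq_trans; apply. Qed.

(** As [u] and [v] are independent, the zero set of the first equation is a curve parametrized by
    [p = dot u y], and the displayed sum is the second equation on it. *)
Lemma triangle_isolated_le F (i j k : 'I_3) n :
  let a := expo F.1 in
  let u := a j - a i in
  let v := a k - a i in
  uniq [:: i; j; k] -> cross u v != 0 ->
  (forall l m : R, vanishes_or_zeros_le (line_dom l m)
     (fun p => \sum_(t < 3) coef F.2 t *
        expR (cross (expo F.2 t) v / cross u v * p +
              cross u (expo F.2 t) / cross u v * line_ln l m p)) n) ->
  isolated_le F n.
Proof.
move=> a u v uijk uv0.
(* These come from solving the first equation, divided by its monomial of index [i], for
   [expR (dot v y)]. *)
set l := - (coef F.1 i / coef F.1 k); set m := - (coef F.1 j / coef F.1 k).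
move=> /(_ l m).
have ci0 := coef_neq0 F.1 i; have cj0 := coef_neq0 F.1 j.
have ck0 := coef_neq0 F.1 k.
(* Cramer's rule for [dot u y = p] and [dot v y = line_ln l m p]. *)
pose g1 (p : R) : R :=
  v.2 / cross u v * p + (- u.2 / cross u v) * line_ln l m p.
pose g2 (p : R) : R :=
  (- v.1 / cross u v) * p + u.1 / cross u v * line_ln l m p.
pose g (p : R) : plane R := (g1 p, g2 p).
have gE (q : plane R) (p : R) : dot q (g p) =
    cross q v / cross u v * p + cross u q / cross u v * line_ln l m p.
  rewrite /g /g1 /g2; case: (u) (v) uv0 => u1 u2 [v1 v2].
  case: q => q1 q2; rewrite dotE !crossE /= => uv0.
  by field.
have f1E y : feval F.1 (exp2 y) = expR (dot (a i) y) *
    (coef F.1 i + coef F.1 j * expR (dot u y) + coef F.1 k * expR (dot v y)).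
  rewrite feval_exp2 (sum_ord3 _ uijk) -/a !dotBl !expRB.
  by have /gt_eqF/negbT e0 := expR_gt0 (dot (a i) y); field.
have g_root1 p : line_dom l m p -> feval F.1 (exp2 (g p)) = 0.
  move=> lp; rewrite f1E !gE divff // /cross [u.2 * u.1]mulrC [v.2 * v.1]mulrC.
  rewrite !subrr !mul0r !mul1r !add0r addr0 expR_line_ln // /l /m.
  by apply/eqP; rewrite mulf_eq0; apply/orP; right; apply/eqP; field.
have g_onto y : feval F.1 (exp2 y) = 0 ->
    line_dom l m (dot u y) /\ y = g (dot u y).
  move/eqP; rewrite f1E mulf_eq0 expR_eq0 /= => /eqP f1y.
  have lE : l + m * expR (dot u y) = expR (dot v y).
    rewrite /l /m; apply: (mulfI ck0); apply/eqP; rewrite -subr_eq0 -oppr_eq0.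
    by apply/eqP; rewrite -[RHS]f1y; field.
  split; first by rewrite /line_dom /= lE expR_gt0.
  rewrite /g /g1 /g2 /line_ln lE expRK.
  case: (u) (v) uv0 => u1 u2 [v1 v2]; case: y {f1y lE} => y1 y2.
  by rewrite !dotE !crossE /= => uv0; congr pair; field.
have f2E (p : R) : feval F.2 (exp2 (g p)) = \sum_(t < 3) coef F.2 t *
        expR (cross (expo F.2 t) v / cross u v * p +
              cross u (expo F.2 t) / cross u v * line_ln l m p).
  by rewrite feval_exp2; apply: eq_bigr => t _; rewrite gE.
case=> [g_root2|g_zeros].
  (* If the second equation vanishes along the curve, every root lies on an arc of roots, so the
     list must be empty. *)
  case=> // z s _ /(_ z (mem_head _ _)) isoz; exfalso.
  have [[zpos /= z1 _] _] := isoz; move: isoz; rewrite -(ln2K zpos) in z1 *.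
  have [lz ->] := g_onto _ z1.
  have dg p : line_dom l m p -> derivable g1 p 1 /\ derivable g2 p 1.
    move=> lp; split.
      by case: (is_derive_affine2 (v.2 / cross u v) (- u.2 / cross u v)
                  (is_derive_line_ln lp)).
    by case: (is_derive_affine2 (- v.1 / cross u v) (u.1 / cross u v)
                  (is_derive_line_ln lp)).
  apply: (@curve_not_isolated _ _ _ _ (line_dom l m) g1 g2 u) lz.
  - exact: line_dom_itv.
  - by move=> p /dg [/derivable1_diffP/differentiable_continuous].
  - by move=> p /dg [_ /derivable1_diffP/differentiable_continuous].
  - move=> p lp; rewrite -/(g p) gE divff // /cross [u.2 * u.1]mulrC subrr.
    by rewrite !mul0r mul1r addr0.
  - move=> p lp; apply/positive_roots_exp2; split; first exact: g_root1.
    by rewrite f2E g_root2.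
  - exact: line_domN.
move=> s us iso.
have s_root z : z \in s ->
    [/\ line_dom l m (dot u (ln2 z)), z = exp2 (g (dot u (ln2 z))) &
        feval F.2 z = 0].
  move=> /iso [[zpos /= z1 z2] _]; rewrite -(ln2K zpos) in z1.
  by have [lz <-] := g_onto _ z1; rewrite ln2K.
(* A root is determined by its parameter, so the parameters of distinct roots are distinct zeros. *)
rewrite -(size_map (fun z => dot u (ln2 z))); apply: g_zeros.
  rewrite map_inj_in_uniq // => z z' /s_root[_ zE _] /s_root[_ z'E _] zz'.
  by rewrite zE zz' -z'E.
move=> _ /mapP[z /s_root[lz zE z2] ->]; split=> //.
by rewrite -f2E -zE.
Qed.

End IsolatedRoots.

(** The list is partitioned by the values of [f]; it serves to count roots line by line. *)
Lemma size_le_fibers (T U : eqType) (f : T -> U) (s : seq T) m n :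
  (size (undup (map f s)) <= m)%N ->
  (forall y, (size [seq x <- s | f x == y] <= n)%N) -> (size s <= m * n)%N.
Proof.
move=> fm fn; apply: leq_trans (leq_mul fm (leqnn n)).
have -> : size s =
    (\sum_(y <- undup (map f s)) size [seq x <- s | f x == y])%N.
  under eq_bigr do rewrite size_filter -sum1_count big_mkcond /=.
  rewrite exchange_big /= -sum1_size big_seq [RHS]big_seq.
  apply: eq_bigr => x xs.
  rewrite (bigD1_seq (f x)) ?undup_uniq ?mem_undup ?map_f //= eqxx.
  by rewrite big1 // => y /negPf; rewrite eq_sym => ->.
rewrite -[size (undup _)]sum1_size big_distrl /=.
by apply: leq_sum => y _; rewrite mul1n.
Qed.

(** * Systems with parallel edges or collinear exponents *)

Section SpecialSystems.
Variable R : realType.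
Implicit Type F : fewnomial_system R 3 3.

(** Parallelism makes [b j' - b i'] a multiple of [a j - a i]. After division by the monomial of
    [b i'], the term of [b j'] therefore depends on p alone. *)
Lemma common_edge_isolated_le F (i j k i' j' k' : 'I_3) :
  let a := expo F.1 in let b := expo F.2 in
  uniq [:: i; j; k] -> uniq [:: i'; j'; k'] ->
  cross (a j - a i) (a k - a i) != 0 ->
  cross (a j - a i) (b j' - b i') = 0 -> isolated_le F 4.
Proof.
move=> a b uijk uijk' D0 par.
apply: (triangle_isolated_le uijk D0) => l m.
set D := cross _ _; set u := a j - a i; set v := a k - a i.
have := common_edge_zeros l m (coef F.2 i') (coef F.2 j') (coef F.2 k')
  (cross (b j' - b i') v / D) (cross (b k' - b i') v / D)
  (cross u (b k' - b i') / D).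
apply: (@vanishes_or_zeros_le_ext _ _ _ (fun p =>
  expR (cross (b i') v / D * p + cross u (b i') / D * line_ln l m p))).
  move=> p _; rewrite (sum_ord3 _ uijk') -/a -/b -/u -/v -/D !mulrDr.
  rewrite mulrC; congr (_ + _ + _); rewrite mulrCA -expRD; congr (_ * expR _).
    have -> : cross u (b j') = cross u (b i').
      by apply/eqP; rewrite -subr_eq0 -crossBr par.
    by rewrite crossBl; field.
  by rewrite crossBl crossBr; field.
by move=> p _; rewrite expR_eq0.
Qed.

(** The three parallelisms make both edges of [b] at [b i'] the same multiple r of the corresponding
    edges of [a], which gives the form c0 + c1 u^r + c2 v^r. *)
Lemma homothetic_isolated_le F (i j k i' j' k' : 'I_3) :
  let a := expo F.1 in let b := expo F.2 in
  uniq [:: i; j; k] -> uniq [:: i'; j'; k'] ->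
  cross (a j - a i) (a k - a i) != 0 ->
  cross (a j - a i) (b j' - b i') = 0 ->
  cross (a k - a i) (b k' - b i') = 0 ->
  cross (a k - a j) (b k' - b j') = 0 -> isolated_le F 2.
Proof.
move=> a b uijk uijk' D0 par1 par2 par3.
apply: (triangle_isolated_le uijk D0) => l m.
set D := cross _ _; set u := a j - a i; set v := a k - a i.
have := homothetic_zeros l m (coef F.2 i') (coef F.2 j') (coef F.2 k')
  (cross (b j' - b i') v / D).
apply: (@vanishes_or_zeros_le_ext _ _ _ (fun p =>
  expR (cross (b i') v / D * p + cross u (b i') / D * line_ln l m p))).
  move=> p _; rewrite (sum_ord3 _ uijk') -/a -/b -/u -/v -/D !mulrDr.
  rewrite mulrC; congr (_ + _ + _); rewrite mulrCA -expRD; congr (_ * expR _).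
    have -> : cross u (b j') = cross u (b i').
      by apply/eqP; rewrite -subr_eq0 -crossBr par1.
    by rewrite crossBl; field.
  have {}D0 : D != 0 by []; clearbody D.
  move: par1 par2 par3; rewrite /u /v.
  case: (a i) (a j) (a k) => x1 x2 [x3 x4] [x5 x6].
  case: (b i') (b j') (b k') => y1 y2 [y3 y4] [y5 y6].
  rewrite !planeB !crossE => par1 par2 par3.
  set q := line_ln _ _ _.
  apply/eqP; rewrite -subr_eq0; apply/eqP.
  have E1 : y1 * (x6 - x2) - y2 * (x5 - x1) =
      y5 * (x6 - x2) - y6 * (x5 - x1).
    by apply/eqP; rewrite -subr_eq0; apply/eqP; rewrite -[RHS]par2; ring.
  (* The two ratios agree: this is the first parallelism plus the second minus the third. *)
  have E2 : (x3 - x1) * (y6 - y2) - (x4 - x2) * (y5 - y1) =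
     (y3 - y1) * (x6 - x2) - (y4 - y2) * (x5 - x1).
    apply/eqP; rewrite -subr_eq0; apply/eqP.
    transitivity (((x3 - x1) * (y4 - y2) - (x4 - x2) * (y3 - y1)) +
     ((x5 - x1) * (y6 - y2) - (x6 - x2) * (y5 - y1)) -
     ((x5 - x3) * (y6 - y4) - (x6 - x4) * (y5 - y3))); first by ring.
    by rewrite par1 par2 par3; ring.
  have -> : (x3 - x1) * y6 - (x4 - x2) * y5 =
     (y3 - y1) * (x6 - x2) - (y4 - y2) * (x5 - x1) +
     ((x3 - x1) * y2 - (x4 - x2) * y1) by rewrite -E2; ring.
  by rewrite -E1; field.
by move=> p _; rewrite expR_eq0.
Qed.

Definition along m (d : plane R) (a : 'I_m -> plane R) : Prop :=
  forall i j, cross d (a i - a j) = 0.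

(** For nonzero [d], this is the point y with [dot d y = t] and [cross d y = s]: coordinates along
    and across [d]. *)
Definition line_pt (d : plane R) (t s : R) : plane R :=
  (d.1 / dot d d * t + - d.2 / dot d d * s,
   d.2 / dot d d * t + d.1 / dot d d * s).

Lemma dot_line_pt q d t s :
  dot q (line_pt d t s) = dot d q / dot d d * t + cross d q / dot d d * s.
Proof.
by case: d q => d1 d2 [q1 q2]; rewrite !dotE !crossE /=; ring.
Qed.

Lemma line_ptE d y : d != 0 -> y = line_pt d (dot d y) (cross d y).
Proof.
move=> /dotself_gt0; case: d y => d1 d2 [y1 y2]; rewrite /line_pt !dotE !crossE.
by move=> /gt_eqF/negbT N0; congr pair => /=; field.
Qed.

(** All exponents have the same cross product with [d], so a change of [s] multiplies every term by
    the same exponential. *)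
Lemma feval_along m (f : fewnomial R m) (i : 'I_m) d t s : along d (expo f) ->
  feval f (exp2 (line_pt d t s)) =
    expR (cross d (expo f i) / dot d d * s) * feval f (exp2 (line_pt d t 0)).
Proof.
move=> fd; rewrite !feval_exp2 mulr_sumr; apply: eq_bigr => j _.
rewrite !dot_line_pt mulrCA -expRD mulr0 addr0 addrC.
have -> // : cross d (expo f j) = cross d (expo f i).
by apply/eqP; rewrite -subr_eq0 -crossBr fd.
Qed.

Lemma line_not_isolated F d t s : d != 0 ->
  (forall r, feval F.1 (exp2 (line_pt d t r)) = 0) ->
  (forall r, feval F.2 (exp2 (line_pt d t r)) = 0) ->
  ~ isolated_root F (exp2 (line_pt d t s)).
Proof.
move=> d0 f1 f2; have N0 := gt_eqF (dotself_gt0 d0).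
have cont (c e : R) (r : R) :
    {for r, continuous (fun r' : R => c + e * r')}.
  have := is_derive_affine c e (is_derive_id r (1 : R)).
  by case=> /derivable1_diffP/differentiable_continuous.
apply: (@curve_not_isolated _ _ _ F setT
  (fun r => d.1 / dot d d * t + - d.2 / dot d d * r)
  (fun r => d.2 / dot d d * t + d.1 / dot d d * r) (- d.2, d.1)) => //.
- move=> r _; have := dotself_gt0 d0; case: (d) => d1 d2; rewrite !dotE /=.
  by move=> /gt_eqF/negbT dd; field.
- by move=> r _; apply/positive_roots_exp2; split; [exact: f1|exact: f2].
- move=> r _; exists (r + 1) => //.
  by rewrite -subr_eq0 addrAC subrr add0r oner_eq0.
Qed.

Lemma segment_isolated_le F d : d != 0 ->
  along d (expo F.1) -> along d (expo F.2) -> isolated_le F 0.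
Proof.
move=> d0 d1 d2 [//|z s] _ /(_ z (mem_head _ _)) isoz; exfalso.
have [[zpos /= z1 z2] _] := isoz.
move: isoz z1 z2; rewrite -(ln2K zpos) (line_ptE (ln2 z) d0).
set t := dot _ _; set r := cross _ _ => isoz.
rewrite (feval_along ord0 _ _ d1) (feval_along ord0 _ _ d2) => /eqP + /eqP.
rewrite !mulf_eq0 !expR_eq0 /= => /eqP z1 /eqP z2.
apply: line_not_isolated d0 _ _ isoz => q.
  by rewrite (feval_along ord0 _ _ d1) z1 mulr0.
by rewrite (feval_along ord0 _ _ d2) z2 mulr0.
Qed.

Lemma along_isolated_le F d : d != 0 -> along d (expo F.1) -> isolated_le F 4.
Proof.
move=> d0 fd s us iso.
pose a := expo F.1; pose o0 : 'I_3 := ord0; pose o1 : 'I_3 := lift ord0 ord0.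
pose o2 : 'I_3 := ord_max.
have u3 : uniq [:: o0; o1; o2] by [].
pose r i := dot d (a i - a o0) / dot d d.
have dd0 : dot d d != 0 by rewrite gt_eqF // dotself_gt0.
(* Differences of exponents have no component across [d], so their component along [d] determines
   them. *)
have r_inj i j : r i = r j -> i = j.
  move/(mulIf (invr_neq0 dd0))/eqP; rewrite -subr_eq0 => /eqP aij.
  apply: (@expo_inj _ _ F.1); rewrite -/a.
  have /= cij := fd i j; rewrite -/a in cij.
  have {}aij : dot d (a i - a j) = 0.
    rewrite -[RHS]aij; case: (d) (a i) (a j) (a o0).
    move=> d1 d2 [x1 x2] [x3 x4] [x5 x6].
    by rewrite !planeB !dotE; ring.
  apply/eqP; rewrite -subr_eq0; apply/eqP.
  by rewrite (line_ptE (a i - a j) d0) aij cij /line_pt !mulr0 addr0.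
have f1E t q : feval F.1 (exp2 (line_pt d t q)) =
    expR (dot (a o0) (line_pt d t q)) *
    (coef F.1 o0 + coef F.1 o1 * expR (r o1 * t) +
     coef F.1 o2 * expR (r o2 * t)).
  rewrite feval_exp2 (sum_ord3 _ u3) -/a !mulrDr.
  rewrite mulrC; congr (_ + _ + _); rewrite mulrCA -expRD; congr (_ * expR _).
    have := fd o1 o0; rewrite -/a crossBr => /eqP; rewrite subr_eq0 => /eqP c10.
    rewrite !dot_line_pt c10 /r; set N := dot d d.
    case: (d) (a o1) (a o0) => [d1 d2] [x1 x2] [x3 x4].
    by rewrite !planeB !dotE; ring.
  have := fd o2 o0; rewrite -/a crossBr => /eqP; rewrite subr_eq0 => /eqP c10.
  rewrite !dot_line_pt c10 /r; set N := dot d d.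
  case: (d) (a o2) (a o0) => [d1 d2] [x1 x2] [x3 x4].
  by rewrite !planeB !dotE; ring.
have r00 : r o0 = 0.
  by rewrite /r subrr; case: (d) => d1 d2; rewrite dotE /=; ring.
(* At most two lines t = const carry roots, with at most two isolated roots on each. *)
apply: (@size_le_fibers _ _ (fun z => dot d (ln2 z)) s 2 2).
  apply: (@trinomial_zeros_le R (coef F.1 o0) (coef F.1 o1) (coef F.1 o2)
           (r o1) (r o2)).
  - exact: coef_neq0.
  - by apply/eqP; rewrite -r00 => /r_inj.
  - by apply/eqP => /r_inj.
  - exact: undup_uniq.
  move=> t; rewrite mem_undup => /mapP[z /iso [[zpos /= z1 _] _] ->].
  split=> //.
  move/eqP: z1; rewrite -{1}(ln2K zpos) {1}(line_ptE (ln2 z) d0) f1E.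
  by rewrite mulf_eq0 expR_eq0 => /eqP.
move=> t; set s' := seq.filter _ s.
have s'P z : z \in s' ->
    z = exp2 (line_pt d t (cross d (ln2 z))) /\ isolated_root F z.
  rewrite mem_filter => /andP[/eqP <- /iso isoz]; split=> //.
  by rewrite -line_ptE // ln2K //; case: isoz => [[]].
have := @trinomial_zeros R setT.
(* On a line with fixed [t], the factors [expR (e i)] are absorbed into the coefficients. The
   exponents [c i] may coincide, so the second equation may vanish on the whole line. *)
pose e i := dot d (expo F.2 i) / dot d d * t.
pose c i := cross d (expo F.2 i) / dot d d.
move/(_ (coef F.2 o0 * expR (e o0)) (coef F.2 o1 * expR (e o1))
  (coef F.2 o2 * expR (e o2)) (c o1 - c o0) (c o2 - c o0)).
have f2E q : feval F.2 (exp2 (line_pt d t q)) = expR (c o0 * q) *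
    (coef F.2 o0 * expR (e o0) +
     coef F.2 o1 * expR (e o1) * expR ((c o1 - c o0) * q) +
     coef F.2 o2 * expR (e o2) * expR ((c o2 - c o0) * q)).
  rewrite feval_exp2 (sum_ord3 _ u3) !dot_line_pt.
  rewrite -/(e o0) -/(e o1) -/(e o2) -/(c o0) -/(c o1) -/(c o2).
  have cB i : (c i - c o0) * q = c i * q - c o0 * q by ring.
  rewrite !cB !expRD !expRN.
  by have /gt_eqF/negbT c0 := expR_gt0 (c o0 * q); field.
case=> [//|f2_0|f2_zeros].
  case s'E : s' => [//|z s2]; exfalso.
  have [|zE isoz] := s'P z; first by rewrite s'E mem_head.
  rewrite zE in isoz; apply: (line_not_isolated d0 _ _ isoz) => q.
    have [[_ /= z1 _] _] := isoz.
    rewrite f1E; move/eqP: z1; rewrite f1E mulf_eq0 expR_eq0 => /eqP ->.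
    by rewrite mulr0.
  by rewrite f2E f2_0 // mulr0.
rewrite -(size_map (fun z => cross d (ln2 z))); apply: f2_zeros.
  rewrite map_inj_in_uniq ?filter_uniq // => z z' /s'P[zE _] /s'P[z'E _] zz'.
  by rewrite zE zz' -z'E.
move=> _ /mapP[z /s'P[zE [[_ /= _ z2] _]] ->]; split=> //.
have /esym/eqP := f2E (cross d (ln2 z)).
by rewrite -zE z2 mulf_eq0 expR_eq0 => /eqP.
Qed.

End SpecialSystems.

(** * Vertices of a Minkowski sum *)

Section Hull.
Variable R : realType.

Lemma convex_hull_ind (A C : set (plane R)) :
    A `<=` C ->
    (forall x y (t : R), C x -> C y -> 0 < t -> t < 1 ->
      C (t *: x + (1 - t) *: y)) ->
  convex_hull A `<=` C.
Proof.
move=> AC Cconv; apply: smallest_sub => //; apply/convex_setW.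
by move=> x y /set_mem Cx /set_mem Cy t t0 t1; apply/mem_set/Cconv.
Qed.

Lemma sub_convex_hull (A : set (plane R)) : A `<=` convex_hull A.
Proof. exact: sub_gen_smallest. Qed.

End Hull.

Lemma conv_id (R : pzRingType) (V : lmodType R) (t : R) (z : V) :
  t *: z + (1 - t) *: z = z.
Proof. by rewrite -scalerDl addrC subrK scale1r. Qed.

Lemma sub_conv (R : pzRingType) (V : lmodType R) (t : R) (x y z : V) :
  z - (t *: x + (1 - t) *: y) = t *: (z - x) + (1 - t) *: (z - y).
Proof. by rewrite !scalerBr addrACA conv_id opprD. Qed.

Section Lex.
Variable R : realType.
Implicit Types (w e t x y : plane R) (c : R).

(* With w and e independent this order is total, so that, unlike for a linear
   functional, the maximum of a finite set of points is always unique. *)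
Definition lexpos w e t : Prop :=
  0 < dot w t \/ (dot w t = 0 /\ 0 < dot e t).

Lemma dotDr w x y : dot w (x + y) = dot w x + dot w y.
Proof.
by case: w x y => w1 w2 [x1 x2] [y1 y2]; rewrite /dot /=; ring.
Qed.

Lemma dotZr w c x : dot w (c *: x) = c * dot w x.
Proof.
by case: w x => w1 w2 [x1 x2]; rewrite /dot /= /GRing.scale /=; ring.
Qed.

Lemma lexposD w e x y : lexpos w e x -> lexpos w e y -> lexpos w e (x + y).
Proof.
rewrite /lexpos !dotDr => -[x0|[-> x0]] [y0|[-> y0]].
- by left; rewrite addr_gt0.
- by left; rewrite addr0.
- by left; rewrite add0r.
- by right; rewrite addr0 addr_gt0.
Qed.

Lemma lexposZ w e c x : 0 < c -> lexpos w e x -> lexpos w e (c *: x).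
Proof.
rewrite /lexpos !dotZr => c0 [x0|[-> x0]]; first by left; rewrite mulr_gt0.
by right; rewrite mulr0 mulr_gt0.
Qed.

Lemma lexpos0 w e : ~ lexpos w e 0.
Proof. by rewrite /lexpos /dot /= !mulr0 addr0 ltxx => -[|[]]. Qed.

Lemma lexpos_total w e x : cross w e != 0 -> x != 0 ->
  lexpos w e x \/ lexpos w e (- x).
Proof.
move=> we x0; rewrite -scaleN1r /lexpos !dotZr !mulN1r !oppr_gt0.
have [wx|wx|wx] := ltgtP (dot w x) 0; [by right; left|by left; left|].
have [ex|ex|ex] := ltgtP (dot e x) 0; first by right; right; rewrite wx oppr0.
  by left; right.
case/eqP: x0; move: w e x we wx ex => [w1 w2] [e1 e2] [x1 x2].
rewrite crossE !dotE => we wx ex; congr pair; apply: (mulfI we); rewrite mulr0.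
  transitivity (e2 * (w1 * x1 + w2 * x2) - w2 * (e1 * x1 + e2 * x2)).
    by ring.
  by rewrite wx ex; ring.
transitivity (w1 * (e1 * x1 + e2 * x2) - e1 * (w1 * x1 + w2 * x2)).
  by ring.
by rewrite wx ex; ring.
Qed.

Definition lexmax m w e (a : 'I_m -> plane R) (i : 'I_m) : Prop :=
  forall j, j != i -> lexpos w e (a i - a j).

Lemma lexmax_exists m w e (a : 'I_m.+1 -> plane R) :
  injective a -> cross w e != 0 -> exists i, lexmax w e a i.
Proof.
move=> a_inj we.
suff [i _ iP] : exists2 i, i \in enum 'I_m.+1 &
    forall j, j \in enum 'I_m.+1 -> j != i -> lexpos w e (a i - a j).
  by exists i => j; apply: iP; rewrite mem_enum.
have : enum 'I_m.+1 != [::] by rewrite -size_eq0 size_enum_ord.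
elim: (enum _) => // k [_ _|k' s /(_ isT) [i si iP] _].
  exists k; rewrite ?mem_head // => j.
  by rewrite inE => /eqP-> /eqP.
have [<-|ki] := eqVneq i k.
  exists i; first exact: mem_head.
  by move=> j; rewrite inE => /predU1P[->/eqP//|]; apply: iP.
have aik : a i - a k != 0.
  by apply: contra_neq ki => /eqP; rewrite subr_eq0 => /eqP/a_inj.
have [ik|] := lexpos_total we aik.
  exists i; first by rewrite inE si orbT.
  by move=> j; rewrite inE => /predU1P[->//|]; apply: iP.
rewrite opprB => kI; exists k; first exact: mem_head.
move=> j; rewrite inE => /predU1P[->/eqP//|sj jk].
have [->//|ji] := eqVneq j i.
have -> : a k - a j = (a k - a i) + (a i - a j) by rewrite addrA subrK.
by apply: lexposD => //; apply: iP.
Qed.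

(** The point [a i] together with all points strictly below it forms a convex set, as [lexpos] is
    stable under sums and positive scaling. *)
Lemma lexmax_hull m w e (a : 'I_m -> plane R) i x : lexmax w e a i ->
  convex_hull (range a) x -> x = a i \/ lexpos w e (a i - x).
Proof.
move=> imax; move: x; apply: convex_hull_ind.
  move=> _ [j _ <-]; have [->|/imax] := eqVneq j i; [by left|by right].
move=> x y t xP yP t0 t1.
have t1' : 0 < 1 - t by rewrite subr_gt0.
move: xP yP => [->|xP] [->|yP].
- by left; rewrite conv_id.
- by right; rewrite sub_conv subrr scaler0 add0r; apply: lexposZ.
- by right; rewrite sub_conv subrr scaler0 addr0; apply: lexposZ.
- by right; rewrite sub_conv; apply: lexposD; apply: lexposZ.
Qed.

(* Then a i + b j is an extreme point of the sum of the two hulls. *)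
Definition exposed m (a b : 'I_m -> plane R) (i j : 'I_m) : Prop :=
  exists w e, [/\ cross w e != 0, lexmax w e a i & lexmax w e b j].

Lemma exposed_sym m (a b : 'I_m -> plane R) i j :
  exposed a b i j -> exposed b a j i.
Proof. by move=> [w [e []]]; exists w, e. Qed.

(** Both differences are zero or lexicographically positive and they add up to zero, so both are
    zero. *)
Lemma exposed_sum_inj m (a b : 'I_m -> plane R) i j i' j' :
  exposed a b i j -> a i + b j = a i' + b j' -> i = i' /\ j = j'.
Proof.
move=> [w [e [_ imax jmax]]] E.
have {}E : (a i - a i') + (b j - b j') = 0.
  by rewrite addrACA -opprD E subrr.
have [ii|ii] := eqVneq i' i; have [jj|jj] := eqVneq j' j => //.
- move: E; rewrite ii subrr add0r => E.
  by have := jmax _ jj; rewrite E => /lexpos0.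
- move: E; rewrite jj subrr addr0 => E.
  by have := imax _ ii; rewrite E => /lexpos0.
- by have := lexposD (imax _ ii) (jmax _ jj); rewrite E => /lexpos0.
Qed.

Lemma exposed_vertex m n (a b : 'I_m -> plane R) (v : 'I_n -> plane R) i j :
  minkowski_sum (convex_hull (range a)) (convex_hull (range b)) =
    convex_hull (range v) ->
  exposed a b i j -> exists k, v k = a i + b j.
Proof.
move=> PE [w [e [we imax jmax]]].
have sum_max x : convex_hull (range v) x ->
    x = a i + b j \/ lexpos w e (a i + b j - x).
  rewrite -PE => -[y /(lexmax_hull imax) yP [z /(lexmax_hull jmax) zP <-]].
  have -> : a i + b j - (y + z) = (a i - y) + (b j - z).
    by rewrite opprD addrACA.
  move: yP zP => [->|yP] [->|zP]; first by left.
  - by right; rewrite subrr add0r.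
  - by right; rewrite subrr addr0.
  - by right; apply: lexposD.
(* Otherwise every [v k] is strictly below [a i + b j]; by convexity so is the whole hull, including
   [a i + b j] itself. *)
apply: contrapT => nv; apply: (@lexpos0 w e).
rewrite -(subrr (a i + b j)).
have : convex_hull (range v) (a i + b j).
  by rewrite -PE; exists (a i); [|exists (b j)] => //;
    apply: sub_convex_hull; [exists i|exists j].
apply: (convex_hull_ind (C := [set x | lexpos w e (a i + b j - x)])).
  move=> _ [k _ <-]; have [|E|//] := sum_max (v k).
    by apply: sub_convex_hull; exists k.
  by case: nv; exists k.
move=> x y t xP yP t0 t1 /=.
rewrite sub_conv.
by apply: lexposD; apply: lexposZ; rewrite // subr_gt0.
Qed.

Definition exposed_le m (a b : 'I_m -> plane R) (l : nat) : Prop :=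
  forall s : seq ('I_m * 'I_m),
    uniq s -> (forall ij, ij \in s -> exposed a b ij.1 ij.2) -> (size s <= l)%N.

Lemma exposed_le_sym m (a b : 'I_m -> plane R) l :
  exposed_le a b l -> exposed_le b a l.
Proof.
move=> ab s us sP; rewrite -(size_map (fun ij => (ij.2, ij.1))); apply: ab.
  by rewrite map_inj_uniq // => -[x1 x2] [y1 y2] [-> ->].
by move=> _ /mapP[x xs ->] /=; apply: exposed_sym; apply: sP.
Qed.

Lemma polygon_exposed_le m (a b : 'I_m -> plane R) l :
  is_polygon l
    (minkowski_sum (convex_hull (range a)) (convex_hull (range b))) ->
  exposed_le a b l.
Proof.
case: l => [[]//|l] [_ [v [_ PE]]] s us sP.
have /choice[f fP] : forall x : 'I_m * 'I_m, exists k : 'I_l.+1,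
    x \in s -> v k = a x.1 + b x.2.
  (* Outside [s] the index [ord0] is a mere default. *)
  move=> x; have [xs|xs] := boolP (x \in s); last by exists ord0.
  by have [k vk] := exposed_vertex PE (sP x xs); exists k.
have fs_uniq : uniq (map f s).
  rewrite map_inj_in_uniq // => -[x1 x2] [y1 y2] xs ys fxy.
  have /= := fP _ xs; rewrite fxy (fP _ ys) /= => /esym E.
  by have [/= -> ->] := exposed_sum_inj (sP _ xs) E.
rewrite -(size_map f) -(card_uniqP fs_uniq) -[X in (_ <= X)%N]card_ord.
exact: max_card.
Qed.

(** All sums lie on the line through [p] and [q]; subtracting two sums with a common summand puts
    the differences of the other summands in its direction. *)
Lemma segment_along m (a b : 'I_m.+1 -> plane R) :
  is_segment
    (minkowski_sum (convex_hull (range a)) (convex_hull (range b))) ->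
  exists d, [/\ d != 0, along d a & along d b].
Proof.
move=> [p [q [pq PE]]]; exists (q - p).
have sumP i j : cross (q - p) (a i + b j - p) = 0.
  have : convex_hull [set p; q] (a i + b j).
    by rewrite -PE; exists (a i); [|exists (b j)] => //;
      apply: sub_convex_hull; [exists i|exists j].
  apply: (convex_hull_ind (C := [set x | cross (q - p) (x - p) = 0])).
    move=> x [->|->] /=; move: p q {pq PE} => [p1 p2] [q1 q2].
      by rewrite /cross /=; ring.
    by rewrite /cross /=; ring.
  move=> x y t /= xP yP _ _.
  transitivity (t * cross (q - p) (x - p) + (1 - t) * cross (q - p) (y - p)).
    move: p q x y {pq PE xP yP} => [p1 p2] [q1 q2] [x1 x2] [y1 y2].
    by rewrite /cross /= /GRing.scale /=; ring.
  by rewrite xP yP !mulr0 addr0.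
split=> [|i j|i j].
- by rewrite subr_eq0 eq_sym; apply/eqP.
- rewrite -(subrr (0 : R)) -{1}(sumP i ord0) -(sumP j ord0) -crossBr.
  by congr cross; rewrite opprB addrA subrK opprD addrACA subrr addr0.
- rewrite -(subrr (0 : R)) -{1}(sumP ord0 i) -(sumP ord0 j) -crossBr.
  by congr cross; rewrite opprB addrA subrK opprD addrACA subrr add0r.
Qed.

End Lex.

(** * Exposed pairs of two triangles *)

Lemma neq_ord3 (i : 'I_3) : exists k, k != i.
Proof. by case: i => [[|i] ?]; [exists ord_max|exists ord0]. Qed.

Lemma uniq_rot3 (T : eqType) (i j k : T) :
  uniq [:: i; j; k] -> uniq [:: j; k; i].
Proof. by rewrite -(rot_uniq 1). Qed.

Lemma third_ord3 (i j : 'I_3) : i != j -> exists k, uniq [:: k; i; j].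
Proof.
move=> ij; have [k] : exists k, k \notin [:: i; j].
  apply/existsP; rewrite -negb_forall; apply/negP => /forallP ijT.
  have : (#|'I_3| <= size [:: i; j])%N.
    by rewrite cardE; apply: uniq_leq_size (enum_uniq _) _ => t _; apply: ijT.
  by rewrite card_ord.
by rewrite !inE => kij; exists k; rewrite /= !inE kij ij.
Qed.

Section ExposedPairs.
Variable R : realType.
Implicit Types (d w e : plane R) (a b : 'I_3 -> plane R).

Definition rot d : plane R := (- d.2, d.1).

Lemma dot_rot d x : dot (rot d) x = cross d x.
Proof. by case: d x => d1 d2 [x1 x2]; rewrite /rot dotE crossE /=; ring. Qed.

Lemma dotZl c d x : dot (c *: d) x = c * dot d x :> R.
Proof.
by case: d x => d1 d2 [x1 x2]; rewrite /dot /= /GRing.scale /=; ring.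
Qed.

Lemma crossZl c d x : cross (c *: d) x = c * cross d x :> R.
Proof.
by case: d x => d1 d2 [x1 x2]; rewrite /cross /= /GRing.scale /=; ring.
Qed.

Lemma crossNl d x : cross (- d) x = - cross d x :> R.
Proof. by rewrite -scaleN1r crossZl mulN1r. Qed.

Lemma crossNr d x : cross d (- x) = - cross d x :> R.
Proof. by case: d x => d1 d2 [x1 x2]; rewrite /cross /=; ring. Qed.

Lemma dotNl d x : dot (- d) x = - dot d x :> R.
Proof. by rewrite -scaleN1r dotZl mulN1r. Qed.

Lemma crossvv d : cross d d = 0.
Proof. by rewrite /cross mulrC subrr. Qed.

Lemma cross_rot d : cross (rot d) d = - dot d d.
Proof. by case: d => d1 d2; rewrite /rot dotE crossE /=; ring. Qed.

Lemma lexpos_ge0 w e x : lexpos w e x -> 0 <= dot w x.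
Proof. by case=> [/ltW|[->]]. Qed.

Lemma lexmax_ge0 w e a i j : lexmax w e a i -> 0 <= dot w (a i - a j).
Proof.
move=> imax; have [->|/imax/lexpos_ge0//] := eqVneq j i.
by rewrite subrr -(scale0r (0 : plane R)) dotZr mul0r.
Qed.

(* Reversing the tie-breaking functional changes the maximum only when w ties,
   and then the two maxima are the endpoints of a face. *)
Lemma lexmax_opp w e a i j : lexmax w e a i -> lexmax w (- e) a j ->
  dot w (a i - a j) = 0.
Proof.
move=> imax jmax; apply/eqP; rewrite eq_le (lexmax_ge0 _ imax) andbT.
by have := lexmax_ge0 i jmax; rewrite -opprB -scaleN1r dotZr mulN1r oppr_ge0.
Qed.

Lemma lexmax_opp_neq w e a i j k : k != i -> dot w (a i - a k) = 0 ->
  lexmax w e a i -> lexmax w (- e) a j -> i != j.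
Proof.
move=> ki tie imax jmax; apply/eqP => ij.
have := jmax k; rewrite -ij => /(_ ki); have := imax k ki.
rewrite /lexpos tie ltxx dotNl oppr_gt0 => -[//|[_ e1]] [//|[_ e2]].
by have := lt_trans e1 e2; rewrite ltxx.
Qed.

Lemma exposed_exists w e a b : injective a -> injective b -> cross w e != 0 ->
  exists i j, [/\ exposed a b i j, lexmax w e a i & lexmax w e b j].
Proof.
move=> a_inj b_inj we; have [i imax] := lexmax_exists a_inj we.
have [j jmax] := lexmax_exists b_inj we.
by exists i, j; split=> //; exists w, e.
Qed.

Definition triangle a : Prop := forall i j k,
  uniq [:: i; j; k] -> cross (a j - a i) (a k - a i) != 0.

Lemma triangleValong a : injective a ->
  triangle a \/ exists2 d, d != 0 & along d a.
Proof.
move=> a_inj; have [tri|] := pselect (triangle a); first by left.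
move/existsNP => [i /existsNP[j /existsNP[k /not_implyP[u]]]].
move=> /negP/negPn/eqP c0; right; exists (a j - a i).
  rewrite subr_eq0; apply/eqP => /a_inj ji.
  by move: u; rewrite ji /= !inE eqxx.
suff ci t : cross (a j - a i) (a t - a i) = 0.
  move=> p q; have -> : a p - a q = (a p - a i) - (a q - a i).
    by rewrite opprB addrA subrK.
  by rewrite crossBr !ci subr0.
have := mem_ord3 t u; rewrite !inE => /or3P[]/eqP-> //.
  by rewrite subrr -(subrr (a i)) crossBr subrr.
exact: crossvv.
Qed.

(* At the top and at the bottom in the direction normal to the segment carrying
   b, both endpoints of that segment occur in a vertex of the sum. *)
Lemma along_exposed_gt3 a b d : injective a -> injective b -> d != 0 ->
  along d b -> ~ along d a -> ~ exposed_le a b 3.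
Proof.
move=> a_inj b_inj d0 db da E3.
have nd : cross (rot d) d != 0.
  by rewrite cross_rot oppr_eq0 gt_eqF ?dotself_gt0.
have [i1 [m1 [E1 i1max m1max]]] := exposed_exists a_inj b_inj nd.
have [|i2 [m2 [E2 i2max m2max]]] :=
  @exposed_exists (rot d) (- d) a b a_inj b_inj.
  by rewrite crossNr oppr_eq0.
have [|i3 [m3 [E3' i3max m3max]]] :=
  @exposed_exists (- rot d) d a b a_inj b_inj.
  by rewrite crossNl oppr_eq0.
have [|i4 [m4 [E4 i4max m4max]]] :=
  @exposed_exists (- rot d) (- d) a b a_inj b_inj.
  by rewrite crossNl crossNr opprK.
have m12 : m1 != m2.
  have [k k1] := neq_ord3 m1; apply: lexmax_opp_neq k1 _ m1max m2max.
  by rewrite dot_rot db.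
have m34 : m3 != m4.
  have [k k3] := neq_ord3 m3; apply: lexmax_opp_neq k3 _ m3max m4max.
  by rewrite dotNl dot_rot db oppr0.
(* An index maximal in two opposite directions would make [cross d] constant on [a], against [da].
   With [m12] and [m34] this makes the four pairs distinct. *)
have topbot i e j e' :
    lexmax (rot d) e a i -> lexmax (- rot d) e' a j -> i != j.
  move=> imax jmax; apply/eqP => ij; apply: da.
  have ci t : cross d (a i - a t) = 0.
    apply/eqP; rewrite eq_le -dot_rot (lexmax_ge0 t imax) andbT.
    by rewrite -oppr_ge0 -dotNl ij (lexmax_ge0 t jmax).
  move=> p q; have -> : a p - a q = (a i - a q) - (a i - a p).
    by rewrite opprB [RHS]addrC addrA subrK.
  by rewrite crossBr !ci subr0.
have i13 := topbot _ _ _ _ i1max i3max; have i14 := topbot _ _ _ _ i1max i4max.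
have i23 := topbot _ _ _ _ i2max i3max; have i24 := topbot _ _ _ _ i2max i4max.
have := E3 [:: (i1, m1); (i2, m2); (i3, m3); (i4, m4)]; apply: contraPP => _ /=.
apply/not_implyP; split.
  rewrite !inE !xpair_eqE (negPf m12) (negPf m34) (negPf i13) (negPf i14).
  by rewrite (negPf i23) (negPf i24) !andbF.
apply/not_implyP; split=> // ij; rewrite !inE.
by case/or4P => /eqP ->.
Qed.

(** The scalar factor fixes the sign: pairing with [a j - a i] gives its square, so the normal
    points away from [a i]. *)
Definition outer_normal a (i j k : 'I_3) : plane R :=
  cross (a j - a k) (a j - a i) *: rot (a j - a k).

Lemma outer_normal_edge a i j k : dot (outer_normal a i j k) (a j - a k) = 0.
Proof.
by rewrite dotZl dot_rot crossvv mulr0.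
Qed.

Lemma cross_basepoint a i j k :
  cross (a j - a k) (a j - a i) = cross (a j - a i) (a k - a i).
Proof.
case: (a i) (a j) (a k) => x1 x2 [y1 y2] [z1 z2].
by rewrite !planeB !crossE; ring.
Qed.

(** The normal ranks the edge above [a i], and the edge vector breaks the remaining tie in favour of
    [a j]. *)
Lemma edge_lexmax a i j k : triangle a -> uniq [:: i; j; k] ->
  lexmax (outer_normal a i j k) (a j - a k) a j.
Proof.
move=> tri u t tj; have := mem_ord3 t u.
rewrite !inE (negPf tj) /= => /orP[]/eqP->.
  left; rewrite dotZl dot_rot cross_basepoint -expr2.
  by rewrite lt_def sqrf_eq0 tri // sqr_ge0.
right; split; first exact: outer_normal_edge.
apply: dotself_gt0; apply: contraNneq (tri _ _ _ u) => jk.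
by rewrite -cross_basepoint jk /cross /= !mul0r subrr.
Qed.

(** The two opposite tie-breakers along the edge select [j] and [k] in [a]. Their partners in [b]
    tie for the normal, so they coincide or span an edge parallel to the given one. *)
Lemma edge_pairs a b i j k : triangle a -> injective a -> injective b ->
  uniq [:: i; j; k] -> exists m m',
  [/\ exposed a b j m, exposed a b k m', cross (a j - a k) (b m - b m') = 0 &
      forall t, 0 <= dot (outer_normal a i j k) (b m - b t)].
Proof.
move=> tri a_inj b_inj u.
have D0 : cross (a j - a k) (a j - a i) != 0 by rewrite cross_basepoint tri.
have u' : uniq [:: i; k; j].
  move: u; rewrite /= !inE !negb_or !andbT => /andP[/andP[-> ->]].
  by rewrite eq_sym.
(* Exchanging [j] and [k] changes the sign of both factors. *)
have nE : outer_normal a i k j = outer_normal a i j k.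
  rewrite /outer_normal; case: (a i) (a j) (a k) => x1 x2 [y1 y2] [z1 z2].
  rewrite !planeB !crossE /rot /=.
  by congr pair; rewrite /GRing.scale /=; ring.
have jmax := edge_lexmax tri u.
have kmax := edge_lexmax tri u'; rewrite nE -opprB in kmax.
have ne : cross (outer_normal a i j k) (a j - a k) != 0.
  rewrite crossZl cross_rot mulf_neq0 // oppr_eq0 gt_eqF // dotself_gt0 //.
  by apply: contraNneq D0 => ->; rewrite /cross /= !mul0r subrr.
have [m mmax] := lexmax_exists b_inj ne.
have ne' : cross (outer_normal a i j k) (- (a j - a k)) != 0.
  by rewrite crossNr oppr_eq0.
have [m' m'max] := lexmax_exists b_inj ne'.
exists m, m'; split.
- by exists (outer_normal a i j k), (a j - a k).
- by exists (outer_normal a i j k), (- (a j - a k)).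
- have /eqP := lexmax_opp mmax m'max.
  by rewrite dotZl dot_rot mulf_eq0 (negPf D0) => /eqP.
- by move=> t; apply: lexmax_ge0 mmax.
Qed.

Lemma exposed_cover a b m : injective a -> injective b -> triangle b ->
  exists i, exposed a b i m.
Proof.
move=> a_inj b_inj tri.
have [m1 /third_ord3[m2 /uniq_rot3 u]] := neq_ord3 m.
have [i [i' [/exposed_sym E _ _ _]]] := edge_pairs tri b_inj a_inj u.
by exists i.
Qed.

(** If both ends of the edge had the same partner [m], partners for the other two vertices of [b]
    would bring the count to four. So the partners differ and span a parallel edge, opposite to
    [i']. *)
Lemma exposed3_edge a b i j k : triangle a -> triangle b ->
    injective a -> injective b -> exposed_le a b 3 -> uniq [:: i; j; k] ->
  exists i', forall j' k', uniq [:: i'; j'; k'] ->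
    cross (a j - a k) (b j' - b k') = 0.
Proof.
move=> tria trib a_inj b_inj E3 u.
have [m [m' [Ej Ek par _]]] := edge_pairs tria a_inj b_inj u.
have [mm'|mm'] := eqVneq m m'.
  rewrite -mm' in Ek; exfalso.
  have [m1 m1m] := neq_ord3 m.
  have [m2] := third_ord3 m1m; rewrite /= !inE => um.
  have [i1 E1] := exposed_cover m1 a_inj b_inj trib.
  have [i2 E2] := exposed_cover m2 a_inj b_inj trib.
  have := E3 [:: (j, m); (k, m); (i1, m1); (i2, m2)].
  apply: contraPP => _ /=; apply/not_implyP; split.
    move: um u; rewrite /= !inE !xpair_eqE !negb_or !negb_and.
    move=> /and3P[/andP[m21 m2m] _ _] /and3P[_ jk _].
    rewrite jk /= ![m == _]eq_sym ![m1 == m2]eq_sym.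
    by rewrite (negPf m1m) (negPf m2m) (negPf m21) !orbT.
  apply/not_implyP; split=> // ij; rewrite !inE.
  by case/or4P => /eqP ->.
have [i' u'] := third_ord3 mm'; exists i' => j' k' v.
have par' : cross (a j - a k) (b m' - b m) = 0.
  by rewrite -[b m' - _]opprB crossNr par oppr0.
have := mem_ord3 j' u'; have := mem_ord3 k' u'.
move: v; rewrite /= !inE => /and3P[/norP[ij ik] jk _].
rewrite ![_ == i']eq_sym (negPf ij) (negPf ik) /=.
by move=> /orP[]/eqP kE /orP[]/eqP jE; rewrite kE jE ?par ?par' //;
  move: jk; rewrite kE jE eqxx.
Qed.

Lemma cross_indep (u v x : plane R) : cross u v != 0 ->
  cross u x = 0 -> cross v x = 0 -> x = 0.
Proof.
move: u v x => [u1 u2] [v1 v2] [x1 x2]; rewrite !crossE => D0 ux vx.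
congr pair; apply: (mulfI D0); rewrite mulr0.
  transitivity (v1 * (u1 * x2 - u2 * x1) - u1 * (v1 * x2 - v2 * x1)).
    by ring.
  by rewrite ux vx; ring.
transitivity (v2 * (u1 * x2 - u2 * x1) - u2 * (v1 * x2 - v2 * x1)).
  by ring.
by rewrite ux vx; ring.
Qed.

(** Each edge of [a] has a parallel edge in [b], and an edge of [b] cannot be parallel to two edges
    of [a]; this matches the edges bijectively. *)
Lemma exposed3_homothetic a b : triangle a -> triangle b ->
    injective a -> injective b -> exposed_le a b 3 ->
  exists i j k i' j' k', [/\ uniq [:: i; j; k], uniq [:: i'; j'; k'],
    cross (a j - a i) (b j' - b i') = 0,
    cross (a k - a i) (b k' - b i') = 0 &
    cross (a k - a j) (b k' - b j') = 0].
Proof.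
move=> tria trib a_inj b_inj E3.
have edge i j k u := @exposed3_edge a b i j k tria trib a_inj b_inj E3 u.
have opp_neq (i j k i' j' : 'I_3) : uniq [:: i; j; k] ->
    (forall p q, uniq [:: i'; p; q] -> cross (a j - a k) (b p - b q) = 0) ->
    (forall p q, uniq [:: j'; p; q] -> cross (a k - a i) (b p - b q) = 0) ->
    i' != j'.
  move=> u Pi Pj; apply/eqP => ij; move: Pj; rewrite -ij => Pj {j' ij}.
  have [p pi] := neq_ord3 i'.
  have [q uq] := third_ord3 pi.
  have uq' := uniq_rot3 (uniq_rot3 uq).
  have /b_inj qp : b q = b p.
    apply/eqP; rewrite -subr_eq0; apply/eqP.
    apply: (cross_indep _ (Pi _ _ uq') (Pj _ _ uq')).
    have -> : a j - a k = (a j - a i) - (a k - a i).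
      by rewrite opprB addrA subrK.
    by rewrite crossBl crossvv subr0; apply: tria.
  by move: uq; rewrite qp /= !inE eqxx.
pose o0 : 'I_3 := ord0; pose o1 : 'I_3 := lift ord0 ord0.
pose o2 : 'I_3 := ord_max.
have u012 : uniq [:: o0; o1; o2] by [].
have u120 := uniq_rot3 u012; have u201 := uniq_rot3 u120.
have [i' Pi] := edge _ _ _ u012.
have [j' Pj] := edge _ _ _ u120.
have [k' Pk] := edge _ _ _ u201.
have ij := opp_neq _ _ _ _ _ u012 Pi Pj.
have jk := opp_neq _ _ _ _ _ u120 Pj Pk.
have ki := opp_neq _ _ _ _ _ u201 Pk Pi.
have u' : uniq [:: i'; j'; k'].
  by rewrite /= !inE (eq_sym i' k') (negPf ij) (negPf jk) (negPf ki).
exists o0, o1, o2, i', j', k'; split=> //.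
- rewrite -opprB crossNl -[b j' - _]opprB crossNr opprK.
  exact: Pk (uniq_rot3 (uniq_rot3 u')).
- have := Pj _ _ (uniq_rot3 u'); by [].
- rewrite -opprB crossNl -[b k' - _]opprB crossNr opprK.
  exact: Pi u'.
Qed.

(* The three outer normals of a triangle sum to zero, hence no vertex of the
   other triangle is the strict maximum of all three. *)
Lemma exposed_gt5 a b : triangle a -> triangle b ->
    injective a -> injective b ->
    (forall i j i' j', i != j -> i' != j' ->
       cross (a i - a j) (b i' - b j') != 0) ->
  ~ exposed_le a b 5.
Proof.
move=> tria trib a_inj b_inj nopar E5.
pose o0 : 'I_3 := ord0; pose o1 : 'I_3 := lift ord0 ord0.
pose o2 : 'I_3 := ord_max.
have u012 : uniq [:: o0; o1; o2] by [].
have u120 := uniq_rot3 u012; have u201 := uniq_rot3 u120.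
have edge i j k : uniq [:: i; j; k] -> exists m, [/\ exposed a b j m,
    exposed a b k m & forall t, t != m ->
      0 < dot (outer_normal a i j k) (b m - b t)].
  move=> u; have [m [m' [Ej Ek par nmax]]] := edge_pairs tria a_inj b_inj u.
  have jk : j != k by move: u; rewrite /= !inE => /and3P[].
  (* Distinct partners would give parallel edges, so the maximum of the normal on [b] is unique. *)
  have mm' : m = m'.
    by apply/eqP; apply: contraPT par => /(nopar _ _ _ _ jk) /eqP.
  exists m; rewrite {2}mm'; split=> // t tm.
  rewrite lt_def nmax andbT dotZl dot_rot mulf_neq0 //.
    by rewrite cross_basepoint tria.
  by apply: nopar; rewrite // eq_sym.
have [m0 [E10 E20 N0]] := edge _ _ _ u012.
have [m1 [E21 E01 N1]] := edge _ _ _ u120.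
have [m2 [E02 E12 N2]] := edge _ _ _ u201.
have not_cst : ~ (m0 = m1 /\ m1 = m2).
  move=> [m01 m12]; move: N1 N2; rewrite -m12 -m01 => N1 N2.
  have [t tm] := neq_ord3 m0.
  have := addr_gt0 (addr_gt0 (N0 t tm) (N1 t tm)) (N2 t tm).
  rewrite !dotZl !dot_rot.
  case: (b m0 - b t) => y1 y2.
  case: (a o0) (a o1) (a o2) => x1 x2 [x3 x4] [x5 x6]; rewrite !planeB !crossE.
  by set S := (X in 0 < X); have -> : S = 0; [rewrite /S; ring|rewrite ltxx].
have cover m := exposed_cover m a_inj b_inj trib.
(* When two of the three maxima coincide, their common vertex [m] is paired with all of [a], the
   other maximum [m'] with two vertices, and the remaining vertex [t] with at least one: six
   pairs. *)
have full i j k m m' : uniq [:: i; j; k] -> m != m' ->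
    exposed a b i m -> exposed a b j m -> exposed a b k m ->
    exposed a b i m' -> exposed a b j m' -> False.
  move=> u mm' E1 E2 E3 E4 E6.
  have [t ut] := third_ord3 mm'; have [c Ec] := cover t.
  have := E5 [:: (i, m); (j, m); (k, m); (i, m'); (j, m'); (c, t)].
  apply/not_implyP; split.
    move: u ut; rewrite /= !inE !xpair_eqE.
    move=> /and3P[/norP[ij ik] jk _] /and3P[/norP[tm tm'] _ _].
    rewrite (negPf ij) (negPf ik) (negPf jk) (negPf mm') ![_ == t]eq_sym.
    by rewrite (negPf tm) (negPf tm') !andbF.
  apply/not_implyP; split=> // ij; rewrite !inE.
  by do 5![case/predU1P => [->//|]] => /eqP ->.
have [m01|m01] := eqVneq m0 m1.
  have m02 : m0 != m2 by apply/eqP => m02; apply: not_cst; rewrite -m01.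
  by apply: full u012 m02 _ _ _ _ _ => //; rewrite m01.
have [m12|m12] := eqVneq m1 m2.
  by apply: (full o1 o2 o0 m1 m0); rewrite // 1?eq_sym // m12.
have [m02|m02] := eqVneq m0 m2.
  by apply: (full o2 o0 o1 m0 m1); rewrite // m02.
(* With three different maxima, each edge of [a] contributes its own two pairs. *)
have := E5 [:: (o1, m0); (o2, m0); (o2, m1); (o0, m1); (o0, m2); (o1, m2)].
apply/not_implyP; split.
  by rewrite /= !inE !xpair_eqE (negPf m01) (negPf m02) (negPf m12) !andbF.
apply/not_implyP; split=> // ij; rewrite !inE.
by do 5![case/predU1P => [->//|]] => /eqP ->.
Qed.

End ExposedPairs.

(** * The three shapes of the Minkowski sum *)

Theorem corollary1 (R : realType) (F : fewnomial_system R 3 3) :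
  let P_F := minkowski_sum (Newt F.1) (Newt F.2) in
  [/\ is_segment P_F -> [set z | isolated_root F z] #<= `I_0,
      is_polygon 3 P_F -> [set z | isolated_root F z] #<= `I_2
    & forall l : nat, l \in [:: 4; 5]%N ->
        is_polygon l P_F -> [set z | isolated_root F z] #<= `I_4].
Proof.
move=> P; have a_inj := @expo_inj _ _ F.1; have b_inj := @expo_inj _ _ F.2.
split=> [/segment_along[d [d0 ad bd]]|/polygon_exposed_le E3|l l45].
- exact/isolated_le_card/(segment_isolated_le d0).
- apply: isolated_le_card.
  (* If one Newton polygon degenerates, having only three exposed pairs forces the other to be
     parallel to it, and no root is isolated. *)
  have [tria|[d d0 ad]] := triangleValong a_inj; last first.
    have [bd|bd] := pselect (along d (expo F.2)).
      exact: isolated_leW (segment_isolated_le d0 ad bd).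
    by have := along_exposed_gt3 b_inj a_inj d0 ad bd (exposed_le_sym E3).
  have [trib|[d d0 bd]] := triangleValong b_inj; last first.
    have [ad|ad] := pselect (along d (expo F.1)).
      exact: isolated_leW (segment_isolated_le d0 ad bd).
    by have := along_exposed_gt3 a_inj b_inj d0 bd ad E3.
  have [i [j [k [i' [j' [k' [u u' p1 p2 p3]]]]]]] :=
    exposed3_homothetic tria trib a_inj b_inj E3.
  exact: homothetic_isolated_le u u' (tria _ _ _ u) p1 p2 p3.
move=> /polygon_exposed_le E; apply: isolated_le_card.
have {}E : exposed_le (expo F.1) (expo F.2) 5.
  move=> s us sP; apply: leq_trans (E s us sP) _.
  by move: l45; rewrite !inE => /orP[]/eqP->.
have [tria|[d d0 ad]] := triangleValong a_inj.
  2: exact: along_isolated_le d0 ad.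
have [trib|[d d0 bd]] := triangleValong b_inj; last first.
  by apply: isolated_le_swap; exact: (@along_isolated_le _ (F.2, F.1) _ d0 bd).
have [[i [j [i' [j' [ij ij' par]]]]]|nopar] := pselect (exists i j i' j',
    [/\ i != j, i' != j' &
        cross (expo F.1 i - expo F.1 j) (expo F.2 i' - expo F.2 j') = 0]).
  have [k u] := third_ord3 ij; have [k' u'] := third_ord3 ij'.
  (* The indices are reordered so that the base point of each edge matches the differences in
     [par]. *)
  have v : uniq [:: j; i; k] by rewrite -rev_uniq; apply: u.
  have v' : uniq [:: j'; i'; k'] by rewrite -rev_uniq; apply: u'.
  exact: common_edge_isolated_le v v' (tria _ _ _ v) par.
case: (exposed_gt5 tria trib a_inj b_inj _ E) => i j i' j' ij ij'.
by apply/eqP => par; apply: nopar; exists i, j, i', j'.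
Qed.
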